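(* Let $x_0\in\mathbb{C}^n$, and let $A^*\in\mathbb{C}^{N\times n}$ be any isometric matrix (i.e. $AA^*=I_n$). Suppose $N\ge 2n$ and $$\max_{0\ne u\in\mathbb{C}^n,\ iu\perp x_0}\ \|u\|^{-1}\,\|\Im(B^*u)\|<1,\qquad B:=A\,\mathrm{diag}\Big\{\frac{A^*x_0}{|A^*x_0|}\Big\}.$$ Let $y^{(k)}$, $k=1,2,3,\dots$, be an FDR sequence, i.e. $y^{(k+1)}=S_{\rm f}(y^{(k)})$ with $$S_{\rm f}(y)=y+A^*A\Big(2b\odot\frac{y}{|y|}-y\Big)-b\odot\frac{y}{|y|},\qquad b=|A^*x_0|,$$ and let $x^{(k)}:=Ay^{(k)}$. If $x^{(1)}$ is sufficiently close to $x_0$, then for some constant $\gamma<1$ $$\|\alpha^{(k)}x^{(k)}-x_0\|\le\gamma^{k-1}\|x^{(1)}-x_0\|,\qquad\forall k,$$ where $\alpha^{(k)}:=\arg\min_{\alpha}\{\|\alpha x^{(k)}-x_0\|:\ |\alpha|=1,\ \alpha\in\mathbb{C}\}$.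
   Context: $|\cdot|$ applied to a vector, $\odot$ and $/$ are component-wise modulus, multiplication and division. For a vector $y\in\mathbb{C}^N$ the phase vector $y/|y|$ has components $y(j)/|y(j)|$ when $y(j)\neq0$, and $1$ when $y(j)=0$. $\Re,\Im$ are taken component-wise. Orthogonality $u\perp v$ for complex vectors is with respect to the real inner product $\langle u,v\rangle=\Re(u^*v)$. Norms are Euclidean. FDR is the Fourier-domain Douglas-Rachford algorithm (without sector constraint).
   Formalization: The FDR sequence is assumed to start at y^(1) = A^* x^(1); for arbitrary y^(1) with A y^(1) = x^(1) the claim fails: n=1, N=2, A=(1,1)/√2, x_0=1, y^(1)=A^*x_0+(it,-it), real t≠0, gives x^(1)=x_0 but |x^(2)|<1. *)

(* Defs.v *)
(* Mathematical Components, with the complex numbers R[i] over R : realType. *)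
From mathcomp Require Import all_boot all_order all_algebra.
From mathcomp Require Import complex.
From mathcomp Require Import classical_sets reals.
Set Implicit Arguments.
Unset Strict Implicit.
Unset Printing Implicit Defensive.
Import Order.TTheory GRing.Theory Num.Theory.
Local Open Scope ring_scope.
Local Open Scope sesquilinear_scope.

Section FourierDomainDouglasRachford.
Variable R : realType.
Local Notation C := R[i].

Definition vabs m (v : 'cV[C]_m) : 'cV[C]_m := map_mx Num.norm v.

Definition vIm m (v : 'cV[C]_m) : 'cV[C]_m := map_mx (fun z => 'Im z) v.

Definition vmul m (v w : 'cV[C]_m) : 'cV[C]_m := map2_mx *%R v w.

(* The vector y / |y|, with the value 1 where y vanishes. *)
Definition phase m (y : 'cV[C]_m) : 'cV[C]_m :=
  map_mx (fun z => if z == 0 then 1 else z / `|z|) y.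

(* R-valued Euclidean norm; the order on C is only partial. *)
Definition enorm m (v : 'cV[C]_m) : R :=
  Num.sqrt (\sum_i ComplexField.Normc.normc (v i 0) ^+ 2).

(* Orthogonality for the real inner product Re (u^* v). *)
Definition rperp m (u v : 'cV[C]_m) : Prop :=
  'Re ((u ^t* *m v) 0 0) = 0.

Definition is_max (E : set R) (s : R) : Prop := E s /\ ubound E s.

(* A : C^N -> C^n is the adjoint of the isometry A^*. *)
Definition Bmx n N (A : 'M[C]_(n, N)) (x0 : 'cV[C]_n) : 'M[C]_(n, N) :=
  A *m diag_mx (phase (A ^t* *m x0))^T.

Definition Sf n N (A : 'M[C]_(n, N)) (b : 'cV[C]_N) (y : 'cV[C]_N) :
    'cV[C]_N :=
  y + A ^t* *m (A *m (2 *: vmul b (phase y) - y)) - vmul b (phase y).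

(* Indices start at 1; y 0 is unconstrained. *)
Definition FDR_seq n N (A : 'M[C]_(n, N)) (b : 'cV[C]_N)
    (y : nat -> 'cV[C]_N) : Prop :=
  forall k, (0 < k)%N -> y k.+1 = Sf A b (y k).

(* alpha is a minimizer of |alpha x - x0| over the unit circle.  It is unique
   unless x^* x0 = 0, in which case every unit alpha is a minimizer. *)
Definition phase_argmin n (x x0 : 'cV[C]_n) (alpha : C) : Prop :=
  `|alpha| = 1 /\
  forall beta : C, `|beta| = 1 ->
    enorm (alpha *: x - x0) <= enorm (beta *: x - x0).

End FourierDomainDouglasRachford.

(* Main.v *)
(* Put B = A diag(A^* x0/|A^* x0|), D = diag(A^* x0/|A^* x0|), P = B^* B, b = |A^* x0|,
   and write a vector near A^* x0 as y = D (b + h).  The derivative of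
   b \odot y/|y| at y = D b is h |-> Q h, where Q is the real-orthogonal projector
   on the imaginary vectors supported where b <> 0, so that the derivative of S_f is
   J h = (I - P)(h - Q h) + P Q h, a sum of two orthogonal terms.  The neutral
   vectors K = {P h = 0, Q h = 0} give a whole manifold of fixed points D (b + k),
   and multiplication by phases gives the neutral direction i b; transversally to
   both, the spectral gap s bounds each of the two terms of J: directly for P Q h,
   and for the first one because h - Q h = (I - Q) B^* u with u orthogonal to i x0.
   Hence |J h| <= s |h| there.  The quadratic remainder is bounded by a multiple of
   |h| |Q h|, which vanishes on K, so after rotating and moving along K the
   transversal part w shrinks by (1 + s)/2 while the drift k along K is controlled by
   |k| + 2 |w|.  Finally A y = x0 + B w up to a phase, since B k = 0. *)
Require Import Defs.
From HB Require Import structures.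
From mathcomp Require Import all_boot all_order all_algebra.
From mathcomp Require Import complex.
From mathcomp Require Import classical_sets reals.
From mathcomp Require Import ring lra.
Import Order.TTheory GRing.Theory Num.Theory.
Local Open Scope ring_scope.
Local Open Scope sesquilinear_scope.
Set Implicit Arguments.
Unset Strict Implicit.
Unset Printing Implicit Defensive.

(** * Real inner product on complex vectors and alignment by a global phase *)

Section RealInnerProduct.
Variable R : realType.
Local Notation C := R[i].
Local Notation "r %:C" := (real_complex R r).
Implicit Types (r : R) (z c : C).

Lemma normc_ge0 z : 0 <= ComplexField.Normc.normc z.
Proof. by case: z => a b; exact: sqrtr_ge0. Qed.

Lemma Re_conjC z : complex.Re (z^*) = complex.Re z.
Proof. by case: z. Qed.

Lemma ReD z c : complex.Re (z + c) = complex.Re z + complex.Re c.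
Proof. by case: z; case: c. Qed.

Lemma ReN z : complex.Re (- z) = - complex.Re z.
Proof. by case: z. Qed.

Lemma ReZ r z : complex.Re (r%:C * z) = r * complex.Re z.
Proof. by case: z => a b /=; rewrite mul0r subr0. Qed.

Lemma Re_sum (I : finType) (F : I -> C) :
  complex.Re (\sum_i F i) = \sum_i complex.Re (F i).
Proof. exact: (big_morph _ ReD). Qed.

Lemma Re_algRe z : 'Re z = (complex.Re z)%:C.
Proof. by rewrite ReJ_add ReE. Qed.

Definition rdot m (u v : 'cV[C]_m) : R := complex.Re ((u ^t* *m v) 0 0).

Lemma rdotE m (u v : 'cV[C]_m) :
  rdot u v = \sum_i complex.Re ((u i 0)^* * v i 0).
Proof. by rewrite /rdot !mxE Re_sum; apply: eq_bigr => i _; rewrite !mxE. Qed.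

Lemma rdotC m (u v : 'cV[C]_m) : rdot u v = rdot v u.
Proof.
rewrite !rdotE; apply: eq_bigr => i _.
by rewrite -Re_conjC rmorphM /= conjCK mulrC.
Qed.

Lemma rdotDr m (u v w : 'cV[C]_m) : rdot u (v + w) = rdot u v + rdot u w.
Proof. by rewrite /rdot mulmxDr mxE ReD. Qed.

Lemma rdotNr m (u v : 'cV[C]_m) : rdot u (- v) = - rdot u v.
Proof. by rewrite /rdot mulmxN mxE ReN. Qed.

Lemma rdotZr m r (u v : 'cV[C]_m) : rdot u (r%:C *: v) = r * rdot u v.
Proof. by rewrite /rdot -scalemxAr mxE ReZ. Qed.

Lemma rdotDl m (u v w : 'cV[C]_m) : rdot (v + w) u = rdot v u + rdot w u.
Proof. by rewrite rdotC rdotDr !(rdotC u). Qed.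

Lemma rdotNl m (u v : 'cV[C]_m) : rdot (- v) u = - rdot v u.
Proof. by rewrite rdotC rdotNr (rdotC u). Qed.

Lemma rdotZl m r (u v : 'cV[C]_m) : rdot (r%:C *: v) u = r * rdot v u.
Proof. by rewrite rdotC rdotZr (rdotC u). Qed.

Lemma rdot0r m (u : 'cV[C]_m) : rdot u 0 = 0.
Proof. by rewrite /rdot mulmx0 mxE. Qed.

Lemma rdot0l m (u : 'cV[C]_m) : rdot 0 u = 0.
Proof. by rewrite rdotC rdot0r. Qed.

Lemma rdot_mulmxl m p (M : 'M[C]_(m, p)) u v :
  rdot (M *m u) v = rdot u (M ^t* *m v).
Proof. by rewrite /rdot trmx_mul map_mxM /= mulmxA. Qed.

Lemma rdot_mulmxr m p (M : 'M[C]_(m, p)) u v :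
  rdot v (M *m u) = rdot (M ^t* *m v) u.
Proof. by rewrite rdotC rdot_mulmxl rdotC. Qed.

Lemma rdot_scale_norm1 m c (u v : 'cV[C]_m) :
  `|c| = 1 -> rdot (c *: u) (c *: v) = rdot u v.
Proof.
move=> c1; rewrite !rdotE; apply: eq_bigr => i _; rewrite !mxE rmorphM /=.
by rewrite mulrACA [c^* * c]mulrC -normCK c1 expr1n mul1r.
Qed.

Lemma rdot_imagl m (u v : 'cV[C]_m) : rdot ('i *: u) v = - rdot u ('i *: v).
Proof.
rewrite -[in RHS](rdot_scale_norm1 _ _ (normCi _)) scalerA.
by rewrite -expr2 sqrCi scaleN1r rdotNr opprK.
Qed.

Lemma rdot_imag m (u : 'cV[C]_m) : rdot u ('i *: u) = 0.
Proof. have := rdot_imagl u u; rewrite rdotC; lra. Qed.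

Lemma rdot_scaler m z (u v : 'cV[C]_m) :
  rdot u (z *: v) = complex.Re (z * (u ^t* *m v) 0 0).
Proof. by rewrite /rdot -scalemxAr mxE. Qed.

Lemma Re_conj_mul z : complex.Re (z^* * z) = (ComplexField.Normc.normc z) ^+ 2.
Proof.
case: z => a b /=; rewrite sqr_sqrtr ?addr_ge0 ?sqr_ge0 //; ring.
Qed.

Lemma sqr_enorm m (u : 'cV[C]_m) : enorm u ^+ 2 = rdot u u.
Proof.
rewrite /enorm sqr_sqrtr; last by apply: sumr_ge0 => i _; exact: sqr_ge0.
by rewrite rdotE; apply: eq_bigr => i _; rewrite Re_conj_mul.
Qed.

Lemma enorm_ge0 m (u : 'cV[C]_m) : 0 <= enorm u.
Proof. exact: sqrtr_ge0. Qed.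

Lemma rdot_ge0 m (u : 'cV[C]_m) : 0 <= rdot u u.
Proof. by rewrite -sqr_enorm sqr_ge0. Qed.

Lemma enormE m (u : 'cV[C]_m) : enorm u = Num.sqrt (rdot u u).
Proof. by rewrite -sqr_enorm sqrtr_sqr ger0_norm // enorm_ge0. Qed.

Lemma rdot_eq0 m (u : 'cV[C]_m) : rdot u u = 0 -> u = 0.
Proof.
rewrite rdotE => /eqP; rewrite psumr_eq0 => [/allP h|i _]; last first.
  by rewrite Re_conj_mul sqr_ge0.
apply/colP => i; rewrite mxE; apply: ComplexField.Normc.eq0_normc.
have := h i (mem_index_enum i); rewrite Re_conj_mul /= sqrf_eq0.
by move/eqP.
Qed.

Lemma enorm_eq0 m (u : 'cV[C]_m) : enorm u = 0 -> u = 0.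
Proof. by move=> h; apply: rdot_eq0; rewrite -sqr_enorm h expr0n. Qed.

Lemma enorm0 m : enorm (0 : 'cV[C]_m) = 0.
Proof. by rewrite enormE rdot0r sqrtr0. Qed.

Lemma enorm_le m p (u : 'cV[C]_m) (v : 'cV[C]_p) (k : R) :
  0 <= k -> rdot u u <= k ^+ 2 * rdot v v -> enorm u <= k * enorm v.
Proof.
move=> k0 h; rewrite -(@ler_pXn2r _ 2) ?nnegrE ?mulr_ge0 ?enorm_ge0 //.
by rewrite exprMn !sqr_enorm.
Qed.

Lemma rdot_le_enorm m (u v : 'cV[C]_m) : rdot u v <= enorm u * enorm v.
Proof.
have [v0|v0] := eqVneq (rdot v v) 0.
  by rewrite (rdot_eq0 v0) rdot0r enorm0 mulr0.
have vp : 0 < rdot v v by rewrite lt_def v0 rdot_ge0.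
apply: (@le_trans _ _ `|rdot u v|); first exact: ler_norm.
rewrite -(@ler_pXn2r _ 2) ?nnegrE ?mulr_ge0 ?enorm_ge0 //.
rewrite exprMn !sqr_enorm real_normK ?num_real //.
(* Cauchy-Schwarz comes from expanding the squared norm of [u] minus its projection onto [v]. *)
have := rdot_ge0 (u + (- (rdot u v / rdot v v))%:C *: v).
rewrite !rdotDr !rdotDl !rdotZr !rdotZl (rdotC v u).
set a := rdot u u; set x := rdot u v; set y := rdot v v.
have -> : a + - (x / y) * x + (- (x / y) * x + - (x / y) * (- (x / y) * y)) =
  (a * y - x ^+ 2) / y by field; exact: v0.
by rewrite pmulr_lge0 ?invr_gt0 // subr_ge0.
Qed.

Lemma normr_rdot_le m (u v : 'cV[C]_m) : `|rdot u v| <= enorm u * enorm v.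
Proof.
rewrite ler_norml rdot_le_enorm andbT lerNl -rdotNl.
by rewrite (le_trans (rdot_le_enorm _ _)) // !enormE rdotNl rdotNr opprK.
Qed.

Lemma enormD m (u v : 'cV[C]_m) : enorm (u + v) <= enorm u + enorm v.
Proof.
rewrite -(@ler_pXn2r _ 2) ?nnegrE ?addr_ge0 ?enorm_ge0 //.
rewrite sqrrD !sqr_enorm rdotDr !rdotDl (rdotC v u).
have := rdot_le_enorm u v; lra.
Qed.

Lemma normC_normc z : `|z| = (ComplexField.Normc.normc z)%:C.
Proof. by []. Qed.

Lemma enormZ m z (u : 'cV[C]_m) :
  enorm (z *: u) = ComplexField.Normc.normc z * enorm u.
Proof.
rewrite enormE rdotE.
under eq_bigr => i _ do
  rewrite mxE Re_conj_mul ComplexField.Normc.normcM exprMn.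
rewrite -mulr_sumr sqrtrM ?sqr_ge0 // sqrtr_sqr /enorm ger0_norm //.
exact: normc_ge0.
Qed.

Lemma enorm_coord m (u : 'cV[C]_m) i :
  ComplexField.Normc.normc (u i 0) <= enorm u.
Proof.
rewrite -(@ler_pXn2r _ 2) ?nnegrE ?enorm_ge0 ?normc_ge0 //.
rewrite sqr_enorm rdotE (bigD1 i) //= Re_conj_mul lerDl.
by apply: sumr_ge0 => j _; rewrite Re_conj_mul sqr_ge0.
Qed.

Lemma enorm_coord_le m (u v : 'cV[C]_m) (k : R) : 0 <= k ->
  (forall i, ComplexField.Normc.normc (u i 0) <=
     k * ComplexField.Normc.normc (v i 0)) ->
  enorm u <= k * enorm v.
Proof.
move=> k0 uv; apply: enorm_le => //; rewrite !rdotE mulr_sumr.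
apply: ler_sum => i _; rewrite !Re_conj_mul -exprMn.
by rewrite ler_pXn2r ?nnegrE ?mulr_ge0 ?normc_ge0.
Qed.

Lemma normc_real r : ComplexField.Normc.normc r%:C = `|r|.
Proof. by rewrite /= expr0n addr0 sqrtr_sqr. Qed.

Lemma normc_le_ReIm z :
  ComplexField.Normc.normc z <= `|complex.Re z| + `|complex.Im z|.
Proof.
case: z => a b /=; rewrite -(@ler_pXn2r _ 2) ?nnegrE ?addr_ge0 ?sqrtr_ge0 //.
rewrite sqr_sqrtr ?addr_ge0 ?sqr_ge0 // sqrrD !real_normK ?num_real //.
by rewrite lerD2r lerDl mulrn_wge0 // mulr_ge0.
Qed.

Lemma normC1_normc z : `|z| = 1 <-> ComplexField.Normc.normc z = 1.
Proof.
rewrite normC_normc; split=> [h|->]; last by rewrite rmorph1.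
exact: (@complexI R).
Qed.

(* The sign of ['i] in [R[i]] is unspecified, only ['i ^+ 2 = -1] is known. *)
Lemma ReM_imaginary z : `|complex.Re (z * 'i)| = `|complex.Im z|.
Proof.
case: z => a b; case Ei : ('i : C) => [x y]; have := sqrCi C.
rewrite Ei expr2 => /eqP; rewrite eq_complex => /andP[/eqP /= h1 /eqP /= h2].
have x0 : x = 0 by move: h1 h2; rewrite oppr0; nra.
rewrite x0 mulr0 sub0r normrN normrM.
have -> : `|y| = 1; last by rewrite mulr1.
by apply/eqP; rewrite -sqr_norm_eq1; apply/eqP; move: h1; rewrite x0; lra.
Qed.

(** For c = conj z / |z| one has (c - 1) |z| = conj z - |z|. Since |z| - Re z <= |Im z|, the
    imaginary part alone bounds how far [c] is from 1. *)
Lemma gauge_scalar z : 0 < complex.Re z -> exists c,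
  [/\ `|c| = 1, c * z = `|z| &
      ComplexField.Normc.normc (c - 1) * complex.Re z <= 2 * `|complex.Im z|].
Proof.
move=> z0; have zn0 : z != 0 by apply: contraTneq z0 => ->; rewrite /= ltxx.
exists (z^* / `|z|); split.
- by rewrite normrM norm_conjC normfV normr_id divff // normr_eq0.
- by rewrite mulrAC [z^* * z]mulrC -normCK expr2 mulfK // normr_eq0.
set c := z^* / `|z|; set M := ComplexField.Normc.normc z.
have M0 : 0 < M.
  rewrite lt_def normc_ge0 andbT; apply: contraNneq zn0.
  by move/ComplexField.Normc.eq0_normc => ->.
have ReM : complex.Re z <= M.
  have := normc_ge_Re z; rewrite normC_normc lecR => /(le_trans _)-> //.
  exact: ler_norm.
have cM : (c - 1) * M%:C = z^* - M%:C.
  by rewrite mulrBl mul1r -normC_normc divfK // normr_eq0.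
have nM : ComplexField.Normc.normc M%:C = M.
  by rewrite normc_real gtr0_norm.
have : ComplexField.Normc.normc (c - 1) * M <= 2 * `|complex.Im z|.
  rewrite -{1}nM -ComplexField.Normc.normcM cM.
  apply: le_trans (normc_le_ReIm _) _.
  have := normc_le_ReIm z; rewrite -/M (gtr0_norm z0).
  case: (z) ReM => a b /= aM bM; rewrite oppr0 addr0 normrN.
  by rewrite distrC ger0_norm; lra.
apply: le_trans; apply: ler_wpM2l => //; exact: normc_ge0.
Qed.

Lemma gauge_near m (b p : 'cV[C]_m) : 0 < enorm b ->
  enorm (p - b) <= enorm b / 2 -> exists c,
  [/\ `|c| = 1, rdot (c *: p) ('i *: b) = 0,
      enorm (c *: p - b) <= enorm (p - b) &
      ComplexField.Normc.normc (c - 1) * enorm b * enorm b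
        <= 4 * `|rdot p ('i *: b)|].
Proof.
move=> b0 pb; pose z := (b ^t* *m p) 0 0.
have zE : z^* = (p ^t* *m b) 0 0.
  rewrite /z !mxE rmorph_sum; apply: eq_bigr => i _.
  by rewrite !mxE rmorphM /= conjCK mulrC.
(* As |p - b| <= |b| / 2, at least half of |b|^2 survives; this turns the constant 2 of
   [gauge_scalar] into 4. *)
have Rez : enorm b * enorm b / 2 <= complex.Re z.
  rewrite -/(rdot b p) -[p](subrK b) rdotDr -sqr_enorm.
  have := normr_rdot_le b (p - b); rewrite ler_norml => /andP[h _].
  have := enorm_ge0 (p - b); nra.
have z0 : 0 < complex.Re z by apply: lt_le_trans Rez; rewrite !divr_gt0 ?mulr_gt0.
have [c [c1 cz cs]] := gauge_scalar z0.
have -> : `|rdot p ('i *: b)| = `|complex.Im z|.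
  rewrite rdot_scaler -zE mulrC ReM_imaginary.
  by case: (z) => x y /=; rewrite normrN.
exists c; split=> //; last by have := normc_ge0 (c - 1); nra.
  rewrite rdotC rdot_imagl scalerA rdot_scaler -mulrA -/z cz mulrC.
  apply/eqP; rewrite oppr_eq0 -normr_eq0 ReM_imaginary normC_normc.
  by rewrite normr_eq0.
have bcp : rdot b p <= rdot b (c *: p).
  rewrite rdot_scaler -/z cz normC_normc /=.
  by have := normc_ge_Re z; rewrite normC_normc lecR; apply/le_trans/ler_norm.
rewrite -[leRHS]mul1r; apply: enorm_le => //; rewrite expr1n mul1r.
rewrite !rdotDl !rdotDr !rdotNl !rdotNr rdot_scale_norm1 //.
by rewrite (rdotC _ b) (rdotC p b); lra.
Qed.

End RealInnerProduct.

(** * Injective real-linear endomorphisms of a complex space *)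

Section RealLinearSurjectivity.
Variable R : realType.
Local Notation C := R[i].
Local Notation "r %:C" := (real_complex R r).

Definition of_reals m (x : 'rV[R]_(m + m)) : 'cV[C]_m :=
  \col_i Complex (x 0 (lshift m i)) (x 0 (rshift m i)).

Definition to_reals m (u : 'cV[C]_m) : 'rV[R]_(m + m) :=
  row_mx (\row_i complex.Re (u i 0)) (\row_i complex.Im (u i 0)).

Lemma to_realsK m : cancel (@to_reals m) (@of_reals m).
Proof.
move=> u; apply/colP => i; rewrite mxE /to_reals row_mxEl row_mxEr !mxE.
by case: (u i 0).
Qed.

Lemma of_realsK m : cancel (@of_reals m) (@to_reals m).
Proof.
move=> x; apply/rowP => i; rewrite /to_reals mxE; case: splitP => j ij.
  by rewrite !mxE /=; congr (x 0 _); apply: val_inj.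
by rewrite !mxE /=; congr (x 0 _); apply: val_inj.
Qed.

(** Maps built from imaginary parts are not complex-linear, so the square-matrix argument is carried
    out over the reals in dimension 2m. *)
Lemma real_linear_surj m (T : 'cV[C]_m -> 'cV[C]_m) :
  (forall u v, T (u + v) = T u + T v) ->
  (forall r u, T (r%:C *: u) = r%:C *: T u) ->
  (forall u, T u = 0 -> u = 0) ->
  forall v, exists u, T u = v.
Proof.
move=> TD TZ T0.
pose f := fun x => to_reals (T (of_reals x)).
have flin : linear f.
  move=> r x y; rewrite /f.
  have -> : of_reals (r *: x + y) = r%:C *: of_reals x + of_reals y.
    apply/colP => i; rewrite !mxE; apply/eqP.
    by rewrite eq_complex /= !mul0r subr0 addr0 !eqxx.
  rewrite TD TZ; apply/rowP => i; rewrite !mxE.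
  case: splitP => j _; rewrite !mxE.
    by case: (T (of_reals x) j 0) => a b; case: (T (of_reals y) j 0) => c d /=;
      rewrite mul0r subr0.
  by case: (T (of_reals x) j 0) => a b; case: (T (of_reals y) j 0) => c d /=;
    rewrite mul0r addr0.
pose F : {linear 'rV[R]_(m + m) -> 'rV[R]_(m + m)} :=
  HB.pack f (GRing.isLinear.Build R _ _ _ f flin).
have Ffree : row_free (lin1_mx F).
  apply: inj_row_free => x; rewrite mul_rV_lin1 /= /f => h.
  rewrite -(of_realsK x); rewrite (T0 (of_reals x)); last first.
    rewrite -(to_realsK (T _)) h; apply/colP => i; rewrite !mxE; exact/eqP.
  by apply/rowP => i; rewrite !mxE; case: splitP => j _; rewrite !mxE.
move=> v; exists (of_reals (to_reals v *m invmx (lin1_mx F))).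
rewrite row_free_unit in Ffree.
have := mulmxKV Ffree (to_reals v); rewrite mul_rV_lin1 /= /f => h.
by rewrite -(to_realsK (T _)) h to_realsK.
Qed.
End RealLinearSurjectivity.

(** * Contraction of the linearized map off its neutral directions *)

Section LinearizedMap.
Variable R : realType.
Local Notation C := R[i].
Local Notation "r %:C" := (real_complex R r).
Variables (n N : nat) (B : 'M[C]_(n, N)) (Q : 'cV[C]_N -> 'cV[C]_N).
Variables (j : 'cV[C]_n) (s : R).
Hypothesis isoB : B *m B ^t* = 1%:M.
Hypothesis QD : forall v w, Q (v + w) = Q v + Q w.
Hypothesis QZ : forall r v, Q (r%:C *: v) = r%:C *: Q v.
Hypothesis Qsym : forall v w, rdot (Q v) w = rdot v (Q w).
Hypothesis Qidem : forall v, Q (Q v) = Q v.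
Hypothesis Qj : Q (B ^t* *m j) = B ^t* *m j.
Hypothesis s_ge0 : 0 <= s.
Hypothesis s_lt1 : s < 1.
Hypothesis gap : forall u, rdot u j = 0 -> enorm (Q (B ^t* *m u)) <= s * enorm u.

Definition neutral (k : 'cV[C]_N) := B *m k = 0 /\ Q k = 0.

(** The reflection 2P - 1 with P = B^* B, an isometry. It is the way an error in the phase term
    enters [Sf]. *)
Definition refl (v : 'cV[C]_N) := B ^t* *m (B *m (v + v)) - v.

(* When [Q] is the derivative of [v |-> b \odot v/|v|] at [b], [linstep] is the
   derivative at [b] of [Sf], read in the coordinates [diag(phase)^* y]. *)
Definition linstep w := w - B ^t* *m (B *m w) + refl (Q w).

Lemma projN v : Q (- v) = - Q v.
Proof. by have := QZ (-1) v; rewrite !rmorphN1 !scaleN1r. Qed.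

Lemma mulmx_coisometryK p (u : 'M[C]_(n, p)) : B *m (B ^t* *m u) = u.
Proof. by rewrite mulmxA isoB mul1mx. Qed.

Lemma rdot_coisometry (u v : 'cV[C]_n) : rdot (B ^t* *m u) (B ^t* *m v) = rdot u v.
Proof. by rewrite -rdot_mulmxl mulmx_coisometryK. Qed.

Lemma rdot_proj v : rdot (Q v) v = rdot (Q v) (Q v).
Proof. by rewrite -{1}Qidem Qsym. Qed.

Lemma rdot_projC v : rdot (v - Q v) v = rdot v v - rdot (Q v) (Q v).
Proof. by rewrite rdotDl rdotNl rdot_proj. Qed.

Lemma rdot_projC_self v : rdot (v - Q v) (v - Q v) = rdot v v - rdot (Q v) (Q v).
Proof.
by rewrite rdotDr rdot_projC rdotNr rdotDl rdotNl (rdotC v (Q v)) rdot_proj; lra.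
Qed.

Lemma gap_sqr u : rdot u j = 0 ->
  rdot (Q (B ^t* *m u)) (Q (B ^t* *m u)) <= s ^+ 2 * rdot u u.
Proof.
move=> uj; rewrite -!sqr_enorm -exprMn.
by rewrite ler_pXn2r ?nnegrE ?mulr_ge0 ?enorm_ge0 ?gap.
Qed.

Lemma sqr_gap_lt1 : s ^+ 2 < 1.
Proof. by rewrite expr_lt1. Qed.

Lemma refl_enorm v : enorm (refl v) = enorm v.
Proof.
rewrite !enormE; congr Num.sqrt; rewrite /refl !mulmxDr.
set p := B ^t* *m (B *m v).
have pp : rdot p p = rdot v p by rewrite rdot_coisometry rdot_mulmxl.
by rewrite !rdotDl !rdotDr !rdotNl !rdotNr (rdotC p v) pp; lra.
Qed.

(** The operator B (1 - Q) B^* kills [j]; adding the rank-one term along [j] makes it injective,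
    hence onto. The solution yields the component of [e - Q e] orthogonal to the neutral space. *)
Lemma gram_solve (e : 'cV[C]_N) : exists2 u, rdot u j = 0 &
  B *m (e - Q e) = B *m (B ^t* *m u - Q (B ^t* *m u)).
Proof.
pose T u := B *m (B ^t* *m u - Q (B ^t* *m u)) + (rdot u j)%:C *: j.
have TD u v : T (u + v) = T u + T v.
  rewrite /T !mulmxDr QD !opprD !mulmxDr !mulmxN rdotDl rmorphD scalerDl /=.
  by rewrite !mulmx_coisometryK [RHS]addrACA; congr (_ + _); rewrite addrACA.
have TZ r u : T (r%:C *: u) = r%:C *: T u.
  rewrite /T -!scalemxAr QZ -scalerBr -!scalemxAr rdotZl rmorphM -scalerA.
  by rewrite -scalerDr.
(* Pairing T u with u gives |(1 - Q) B^* u|^2 + <u, j>^2, a sum of two nonnegative terms; once the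
   second vanishes, the gap applies to the first. *)
have T0 u : T u = 0 -> u = 0.
  move=> Tu; have : rdot (T u) u = 0 by rewrite Tu rdot0l.
  rewrite /T rdotDl rdot_mulmxl rdot_projC rdotZl (rdotC j) rdot_coisometry.
  move=> h; have h1 := rdot_projC_self (B ^t* *m u).
  have h2 := rdot_ge0 (B ^t* *m u - Q (B ^t* *m u)).
  rewrite h1 rdot_coisometry in h2.
  have uj : rdot u j = 0.
    by move: h; set x := rdot u j; nra.
  have h3 := gap_sqr uj; have h4 := rdot_ge0 u; have h5 := sqr_gap_lt1.
  apply: rdot_eq0; move: h; rewrite uj; nra.
have [u Tu] := real_linear_surj TD TZ T0 (B *m (e - Q e)).
(* The range of B (1 - Q) is orthogonal to [j] because Q fixes B^* j; pairing the equation with [j]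
   leaves <u, j> |j|^2 = 0. *)
have uj : rdot u j = 0.
  have h v : rdot (B *m (v - Q v)) j = 0.
    by rewrite rdot_mulmxl rdotDl rdotNl Qsym Qj subrr.
  have := h e; rewrite -Tu rdotDl h rdotZl add0r => /eqP.
  rewrite mulf_eq0 => /orP[/eqP//|/eqP/rdot_eq0->]; exact: rdot0r.
by exists u => //; rewrite -Tu /T uj rmorph0 scale0r addr0.
Qed.

Lemma rdot_projC_neutral u k : neutral k ->
  rdot (B ^t* *m u - Q (B ^t* *m u)) k = 0.
Proof.
by case=> Bk Qk; rewrite rdotDl rdotNl Qsym Qk rdot0r -rdot_mulmxr Bk rdot0r subrr.
Qed.

Lemma neutral_sub e u : B *m (e - Q e) = B *m (B ^t* *m u - Q (B ^t* *m u)) ->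
  neutral ((e - Q e) - (B ^t* *m u - Q (B ^t* *m u))).
Proof.
move=> h; split; first by rewrite mulmxBr h subrr.
have Q0 v : Q (v - Q v) = 0 by rewrite QD projN Qidem subrr.
by rewrite QD projN !Q0 subrr.
Qed.

(** Removing [k] leaves Q e + (1 - Q) B^* u, and both terms are orthogonal to every neutral
    vector. *)
Lemma neutral_proj e : exists2 k, neutral k &
  forall k', neutral k' -> rdot (e - k) k' = 0.
Proof.
have [u _ h] := gram_solve e.
exists ((e - Q e) - (B ^t* *m u - Q (B ^t* *m u))); first exact: neutral_sub.
move=> k' Kk'; rewrite opprB addrCA rdotDl rdot_projC_neutral // opprB addrC subrK.
by case: Kk' => _ Qk'; rewrite Qsym Qk' rdot0r addr0.
Qed.

(** Here |a|^2 = <B a, u> <= |B a| |u|, while the gap gives (1 - s^2) |u|^2 <= |a|^2. In consequence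
    |a - P a| <= s |a|. *)
Lemma enorm_projC_lower a u : rdot u j = 0 -> a = B ^t* *m u - Q (B ^t* *m u) ->
  (1 - s ^+ 2) * rdot a a <= rdot (B *m a) (B *m a).
Proof.
move=> uj ae; have au : rdot (B *m a) u = rdot a a.
  by rewrite rdot_mulmxl ae rdot_projC rdot_projC_self.
have aau : (1 - s ^+ 2) * rdot u u <= rdot a a.
  by rewrite ae rdot_projC_self rdot_coisometry; have := gap_sqr uj; lra.
have cs : rdot a a ^+ 2 <= rdot (B *m a) (B *m a) * rdot u u.
  rewrite -au -!sqr_enorm -exprMn -[_ ^+ 2]real_normK ?num_real //.
  by rewrite ler_pXn2r ?nnegrE ?mulr_ge0 ?enorm_ge0 ?normr_rdot_le.
have a0 := rdot_ge0 a; have [/rdot_eq0 u0|un0] := eqVneq (rdot u u) 0.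
  move: cs; rewrite u0 rdot0r mulr0 => cs.
  have -> : rdot a a = 0 by apply/eqP; rewrite -sqrf_eq0 eq_le cs sqr_ge0.
  by rewrite mulr0 rdot_ge0.
have u0 : 0 < rdot u u by rewrite lt_def un0 rdot_ge0.
rewrite -(ler_pM2r u0); apply: le_trans cs; rewrite expr2 mulrAC.
by rewrite ler_wpM2r.
Qed.

(** The gap by duality: for u = B Q w, |u|^2 = <Q w, Q B^* u> <= s |Q w| |u|. *)
Lemma enorm_mulmx_proj w : rdot w (B ^t* *m j) = 0 ->
  enorm (B *m Q w) <= s * enorm (Q w).
Proof.
move=> wj; set u := B *m Q w.
have uj : rdot u j = 0 by rewrite rdot_mulmxl Qsym Qj.
have h : rdot u u <= enorm (Q w) * (s * enorm u).
  rewrite {1}/u rdot_mulmxl -{1}Qidem Qsym.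
  by rewrite (le_trans (rdot_le_enorm _ _)) // ler_wpM2l ?enorm_ge0 ?gap.
have [u0|un0] := eqVneq (enorm u) 0; first by rewrite u0 mulr_ge0 ?enorm_ge0.
have u0 : 0 < enorm u by rewrite lt_def un0 enorm_ge0.
by rewrite -(ler_pM2r u0) -expr2 sqr_enorm (le_trans h) // mulrCA mulrA.
Qed.

Lemma linstep_contract w : (forall k, neutral k -> rdot w k = 0) ->
  rdot w (B ^t* *m j) = 0 -> enorm (linstep w) <= s * enorm w.
Proof.
move=> wK wj; set g := Q w; pose a := w - g.
have [u uj h] := gram_solve w.
have Kk := neutral_sub h; set k := _ - (_ - _) in Kk.
(* Orthogonality of [w] to the neutral space kills this component, so [w - Q w] has the form
   required by [enorm_projC_lower]. *)
have k0 : k = 0.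
  apply: rdot_eq0; rewrite {1}/k rdotDl rdotNl rdot_projC_neutral // subr0.
  by rewrite rdotDl rdotNl Qsym wK //; case: Kk => _ ->; rewrite rdot0r subr0.
have ae : a = B ^t* *m u - Q (B ^t* *m u) by apply/eqP; rewrite -subr_eq0 -k0.
have lo := enorm_projC_lower uj ae.
have gg : rdot (B *m g) (B *m g) <= s ^+ 2 * rdot g g.
  rewrite -!sqr_enorm -exprMn.
  by rewrite ler_pXn2r ?nnegrE ?mulr_ge0 ?enorm_ge0 ?enorm_mulmx_proj.
have ww : rdot w w = rdot a a + rdot g g by rewrite rdot_projC_self /g; lra.
(* The summands (1 - P) a and P g are orthogonal, and so are [a] and [g]; the two bounds by s
   therefore add up by Pythagoras. *)
have -> : linstep w = (a - B ^t* *m (B *m a)) + B ^t* *m (B *m g).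
  rewrite /linstep /refl /a -/g !mulmxDr !mulmxN.
  set Pw := B ^t* *m _; set Pg := B ^t* *m _.
  by apply/colP => i; rewrite !mxE; ring.
clearbody a; apply: enorm_le => //; rewrite ww !rdotDl !rdotDr !rdotNl !rdotNr.
rewrite !rdot_coisometry -!rdot_mulmxl -!rdot_mulmxr.
by rewrite (rdotC (B *m g)); lra.
Qed.

(** Together with [linstep_gauge], this keeps transverse vectors transverse, so only the error [e]
    needs correction in [gauge_step]. *)
Lemma linstep_neutral w k : neutral k -> rdot (linstep w) k = rdot w k.
Proof.
case=> Bk Qk; rewrite /linstep /refl !rdotDl !rdotNl Qsym Qk rdot0r.
by rewrite -!rdot_mulmxr Bk !rdot0r; lra.
Qed.

Lemma linstep_gauge w : rdot (linstep w) (B ^t* *m j) = rdot w (B ^t* *m j).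
Proof.
rewrite /linstep /refl !rdotDl !rdotNl !rdot_coisometry Qsym Qj.
by rewrite !rdot_mulmxl !rdotDl !Qsym Qj; lra.
Qed.

Definition transverse (w : 'cV[C]_N) :=
  (forall k, neutral k -> rdot w k = 0) /\ rdot w (B ^t* *m j) = 0.

Lemma neutral_proj_enorm e : exists k, [/\ neutral k, enorm k <= enorm e,
  enorm (e - k) <= enorm e & forall k', neutral k' -> rdot (e - k) k' = 0].
Proof.
have [k Kk h] := neutral_proj e; exists k.
have ee : rdot e e = rdot k k + rdot (e - k) (e - k).
  have ek : rdot e k = rdot k k.
    by apply/eqP; rewrite -subr_eq0 -rdotNl -rdotDl; apply/eqP/h.
  by rewrite !rdotDr !rdotDl !rdotNr !rdotNl (rdotC k e); lra.
split=> //; rewrite -[leRHS]mul1r; apply: enorm_le => //;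
  rewrite expr1n mul1r ee ?lerDl ?lerDr rdot_ge0 //.
Qed.

Variable b : 'cV[C]_N.
Hypothesis bj : 'i *: b = B ^t* *m j.
Hypothesis b_gt0 : 0 < enorm b.

(** The phase is corrected first, since b, k and [linstep w] have no component along i b and the
    rotation is paid for by [e] alone. The resulting error [f] is then split into a neutral part,
    added to [k], and a part kept in [w']. *)
Lemma gauge_step k w e : neutral k -> transverse w ->
  enorm e <= enorm w -> enorm k + 2 * enorm w <= enorm b / 2 ->
  exists c k' w', [/\ `|c| = 1, c *: (b + k + linstep w + e) = b + k' + w',
    neutral k', transverse w' &
    enorm w' <= s * enorm w + 9 * enorm e /\
    enorm k' <= enorm k + 9 * enorm e].
Proof.
move=> Kk [wK wj] ew small; set p := _ + e.
have jb : rdot b (B ^t* *m j) = 0 by rewrite -bj rdot_imag.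
have Kj k' : neutral k' -> rdot k' (B ^t* *m j) = 0.
  by case=> Bk' _; rewrite -rdot_mulmxl Bk' rdot0l.
have enib : enorm (B ^t* *m j) = enorm b.
  by rewrite -bj enormZ (_ : ComplexField.Normc.normc 'i = 1) ?mul1r //;
    apply: complexI; rewrite -normC_normc normCi.
have Jw := linstep_contract wK wj.
have pb : enorm (p - b) <= enorm b / 2.
  have -> : p - b = k + (linstep w + e) by apply/colP => i; rewrite !mxE; ring.
  have := enormD k (linstep w + e); have := enormD (linstep w) e.
  have : s * enorm w <= enorm w by rewrite ler_piMl ?enorm_ge0 // ltW.
  by lra.
have pj : `|rdot p (B ^t* *m j)| <= enorm e * enorm b.
  rewrite /p rdotDl (rdotDl _ (b + k)) (rdotDl _ b) jb (Kj _ Kk).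
  rewrite linstep_gauge wj !add0r -enib.
  exact: normr_rdot_le.
have [c [c1 cp _ cs]] := gauge_near b_gt0 pb; rewrite bj in cp cs.
have pn : enorm p <= 3 / 2 * enorm b.
  by have := enormD (p - b) b; rewrite subrK; lra.
pose f := e + (c - 1) *: p.
(* The rotation moves [p] by at most 4 |e| times 3/2, so |f| <= 7 |e|; the constant 9 leaves
   slack. *)
have fe : enorm f <= 9 * enorm e.
  apply: le_trans (enormD _ _) _; rewrite enormZ.
  have h : ComplexField.Normc.normc (c - 1) * enorm b <= 4 * enorm e.
    rewrite -(ler_pM2r b_gt0) (le_trans cs) //; move: pj; lra.
  by have := ler_wpM2l (normc_ge0 (c - 1)) pn; have := enorm_ge0 e; lra.
have [l [Kl lf mf mK]] := neutral_proj_enorm f.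
have eq : c *: p = b + (k + l) + (linstep w + (f - l)).
  rewrite -[c](subrK 1) scalerDl scale1r {2}/p.
  by apply/colP => i; rewrite !mxE; ring.
have Kkl : neutral (k + l).
  by case: Kk Kl => Bk Qk [Bl Ql]; split; rewrite ?mulmxDr ?QD ?Bk ?Bl ?Qk ?Ql addr0.
exists c, (k + l), (linstep w + (f - l)); split=> //.
  split=> [k' Kk'|]; first by rewrite rdotDl linstep_neutral // wK // mK // addr0.
  by move: cp; rewrite eq rdotDl (rdotDl _ b) jb (Kj _ Kkl) !add0r.
split; first by have := enormD (linstep w) (f - l); lra.
by have := enormD k l; lra.
Qed.
End LinearizedMap.

(** * First-order expansion of the phase map, with remainder *)

Section PhaseApproximation.
Variable R : realType.
Local Notation C := R[i].
Local Notation "r %:C" := (real_complex R r).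
Local Notation normc := ComplexField.Normc.normc.

Definition skew (z : C) : C := Complex 0 (complex.Im z).

Lemma normc_skew z : normc (skew z) = `|complex.Im z|.
Proof. by rewrite /= expr0n add0r sqrtr_sqr. Qed.

Lemma normc_Im (z : C) : normc ('Im z) = `|complex.Im z|.
Proof.
rewrite ImE !ComplexField.Normc.normcM.
have -> : z^* - z = Complex 0 (-2 * complex.Im z).
  case: z => a b; apply/eqP; rewrite eq_complex /= subrr eqxx /=.
  by apply/eqP; lra.
have -> : normc ('i : C) = 1 by apply/normC1_normc; exact: normCi.
rewrite ComplexField.Normc.normcV -(rmorph_nat (real_complex R)) normc_real.
rewrite /= expr0n add0r sqrtr_sqr normrM normrN normr_nat mul1r mulrAC.
by rewrite divff ?mul1r ?pnatr_eq0.
Qed.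

(** With m = |beta + h| and r = beta + Re h, the error has real part beta (r - m) / m and imaginary
    part Im h (beta - m) / m. Since m^2 - r^2 = (Im h)^2, both carry a factor |Im h|, contributing 4
    and 2 to the constant 6. This factor, rather than a second |h|, makes the remainder vanish in
    neutral directions. *)
Lemma phase_approx (beta : R) (h : C) : 0 < beta -> normc h <= beta / 2 ->
  normc (beta%:C * ((beta%:C + h) / `|beta%:C + h|) - beta%:C - skew h)
    <= 6 / beta * normc h * normc (skew h).
Proof.
move=> b0 hb; rewrite normC_normc normc_skew.
set m := normc (beta%:C + h).
have mb1 : m <= beta + normc h.
  apply: le_trans (le_normcD _ _) _.
  by rewrite /= expr0n addr0 sqrtr_sqr ger0_norm // ltW.
have mb2 : beta <= m + normc h.
  have := le_normcD (beta%:C + h) (- h).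
  rewrite addrK normcN {1}/normc /= expr0n addr0 sqrtr_sqr.
  by rewrite ger0_norm // ltW.
have m0 : 0 < m by lra.
have m2 : m ^+ 2 = (beta + complex.Re h) ^+ 2 + complex.Im h ^+ 2.
  rewrite /m; case: (h) => a b /=; rewrite sqr_sqrtr ?addr_ge0 ?sqr_ge0 //; ring.
have rm : beta + complex.Re h <= m.
  rewrite (le_trans (ler_norm _)) // -(@ler_pXn2r _ 2) ?nnegrE ?normc_ge0 //.
  by rewrite m2 real_normK ?num_real // lerDl sqr_ge0.
have yh : `|complex.Im h| <= normc h.
  rewrite -(@ler_pXn2r _ 2) ?nnegrE ?normc_ge0 // real_normK ?num_real //.
  by case: (h) => a b /=; rewrite sqr_sqrtr ?addr_ge0 ?sqr_ge0 // lerDr sqr_ge0.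
have xh : `|complex.Re h| <= normc h.
  rewrite -(@ler_pXn2r _ 2) ?nnegrE ?normc_ge0 // real_normK ?num_real //.
  by case: (h) => a b /=; rewrite sqr_sqrtr ?addr_ge0 ?sqr_ge0 // lerDl sqr_ge0.
set r := beta + _ in m2 rm.
have r0 : beta / 2 <= r by move: xh; rewrite /r ler_norml => /andP[]; lra.
have -> : beta%:C * ((beta%:C + h) / m%:C) - beta%:C - skew h =
    Complex (beta * (r - m) / m) (complex.Im h * (beta - m) / m).
  rewrite -fmorphV; apply/eqP; rewrite eq_complex /r; case: (h) => a b /=.
  by apply/andP; split; apply/eqP; field; exact: lt0r_neq0.
apply: le_trans (normc_le_ReIm _) _; rewrite /=.
set y := complex.Im h in m2 yh *.
have e1 : `|beta * (r - m) / m| <= 4 / beta * normc h * `|y|.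
  have -> : `|beta * (r - m) / m| = beta * (m - r) / m.
    rewrite !normrM normfV distrC (gtr0_norm b0) (gtr0_norm m0) ger0_norm //.
    by rewrite subr_ge0.
  have yy : y ^+ 2 <= normc h * `|y|.
    by rewrite -(real_normK (num_real y)) expr2 ler_wpM2r.
  rewrite ler_pdivrMr //.
  have -> : 4 / beta * normc h * `|y| * m = (4 * m * (normc h * `|y|)) / beta.
    by field; exact: lt0r_neq0.
  rewrite ler_pdivlMr //.
  have : (m - r) * (m + r) <= normc h * `|y| by move: m2 yy; rewrite !expr2; lra.
  have t0 : 0 <= normc h * `|y| by rewrite mulr_ge0 ?normc_ge0.
  move: t0; set t := normc h * _ => t0 ht.
  have ht2 : (m - r) * (beta / 2) <= t.
    by apply: le_trans ht; apply: ler_wpM2l; lra.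
  by nra.
have e2 : `|y * (beta - m) / m| <= 2 / beta * normc h * `|y|.
  rewrite !normrM normfV (gtr0_norm m0) ler_pdivrMr //.
  have bm : `|beta - m| <= normc h by rewrite ler_norml; lra.
  have -> : 2 / beta * normc h * `|y| * m = `|y| * normc h * (2 * m / beta).
    by field; exact: lt0r_neq0.
  have : 1 <= 2 * m / beta by rewrite ler_pdivlMr //; lra.
  move=> h1; apply: le_trans (_ : `|y| * normc h <= _); first exact: ler_wpM2l.
  by rewrite ler_peMr // mulr_ge0 ?normc_ge0.
apply: le_trans (lerD e1 e2) _.
by lra.
Qed.

Variables (N : nat) (beta : 'I_N -> R).
Hypothesis beta_ge0 : forall l, 0 <= beta l.

Definition realvec : 'cV[C]_N := \col_l (beta l)%:C.

(* Derivative at [realvec] of [y |-> realvec \odot y/|y|]; the coordinates where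
   [realvec] vanishes do not contribute. *)
Definition skewproj (v : 'cV[C]_N) : 'cV[C]_N :=
  \col_l if beta l == 0 then 0 else skew (v l 0).

Lemma skewprojD v w : skewproj (v + w) = skewproj v + skewproj w.
Proof.
apply/colP => l; rewrite !mxE; case: eqP => _; first by rewrite addr0.
apply/eqP; case: (v l 0) => a b; case: (w l 0) => c d.
by rewrite eq_complex /= addr0 !eqxx.
Qed.

Lemma skewprojZ r v : skewproj (r%:C *: v) = r%:C *: skewproj v.
Proof.
apply/colP => l; rewrite !mxE; case: eqP => _; first by rewrite mulr0.
apply/eqP; case: (v l 0) => a b.
by rewrite eq_complex /= !mul0r mulr0 subr0 !addr0 !eqxx.
Qed.

Lemma skewproj_sym v w : rdot (skewproj v) w = rdot v (skewproj w).
Proof.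
rewrite !rdotE; apply: eq_bigr => l _; rewrite !mxE.
case: eqP => _; first by rewrite rmorph0 mul0r mulr0.
by case: (v l 0) => a b; case: (w l 0) => c d /=; ring.
Qed.

Lemma skewprojK v : skewproj (skewproj v) = skewproj v.
Proof. by apply/colP => l; rewrite !mxE; case: (beta l == 0). Qed.

Lemma skewproj_imag_realvec : skewproj ('i *: realvec) = 'i *: realvec.
Proof.
apply/colP => l; rewrite !mxE; case: eqP => [->|_]; first by rewrite rmorph0 mulr0.
have : 'i * (beta l)%:C + ('i * (beta l)%:C)^* = 0 :> C.
  rewrite rmorphM /= conjCi mulNr.
  have -> : (beta l)%:C^* = (beta l)%:C :> C by exact: conjc_real.
  by rewrite subrr.
case: ('i * _) => a b /eqP; rewrite eq_complex /= => /andP[/eqP h _].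
by apply/eqP; rewrite eq_complex /= eqxx andbT; apply/eqP; lra.
Qed.

Lemma enorm_skewproj_le_vIm v : enorm (skewproj v) <= enorm (vIm v).
Proof.
rewrite -[leRHS]mul1r; apply: enorm_coord_le => // l; rewrite !mxE mul1r normc_Im.
by case: eqP => _; rewrite ?normc_skew // ComplexField.Normc.normc0.
Qed.

Lemma enorm_skewproj_le v : enorm (skewproj v) <= enorm v.
Proof.
rewrite -[leRHS]mul1r; apply: enorm_coord_le => // l; rewrite !mxE mul1r.
case: eqP => _; rewrite ?ComplexField.Normc.normc0 ?normc_ge0 //.
case: (v l 0) => a b; rewrite normc_skew /=; rewrite -sqrtr_sqr ler_wsqrtr //.
by rewrite lerDr sqr_ge0.
Qed.

(** Coordinatewise use of [phase_approx]; the rotation [d] passes through the phase because its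
    entries are unimodular. *)
Lemma vmul_phase_approx (L : R) (y h d : 'cV[C]_N) :
  0 <= L -> (forall l, beta l != 0 -> 6 / beta l <= L) ->
  (forall l, `|d l 0| = 1) -> vmul d y = realvec + h -> L * enorm h <= 1 ->
  enorm (vmul d (vmul realvec (phase y)) - realvec - skewproj h)
    <= L * enorm h * enorm (skewproj h).
Proof.
move=> Lp hL d1 dy hs.
have L0 l : beta l != 0 -> 0 < beta l by move=> bl; rewrite lt_def bl beta_ge0.
apply: enorm_coord_le; first by rewrite mulr_ge0 ?enorm_ge0.
move=> l; rewrite !mxE; have [->|bl] := eqVneq (beta l) 0.
  by rewrite !rmorph0 mul0r mulr0 !subr0 ComplexField.Normc.normc0 mulr0.
have b0 := L0 _ bl; have hl := enorm_coord h l.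
have dyl : d l 0 * y l 0 = (beta l)%:C + h l 0.
  by have := congr1 (fun v : 'cV[C]_N => v l 0) dy; rewrite !mxE.
have small : normc (h l 0) <= beta l / 2.
  have : 6 / beta l * normc (h l 0) <= 1.
    by apply: le_trans hs; apply: ler_pM; rewrite ?normc_ge0 ?divr_ge0 ?beta_ge0 ?hL.
  by rewrite mulrAC ler_pdivrMr // => ?; lra.
(* Smallness of [h] keeps [y] away from 0 here, so the default phase 1 can occur only where [beta]
   vanishes and the modulus factor cancels it. *)
have yl0 : y l 0 != 0.
  apply: contraTneq small => yl; move: dyl; rewrite yl mulr0 => /esym/eqP.
  rewrite addrC addr_eq0 => /eqP ->; rewrite normcN normc_real gtr0_norm //.
  by rewrite -ltNge; lra.
rewrite (negbTE yl0) mulrCA.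
have -> : d l 0 * (y l 0 / `|y l 0|) = ((beta l)%:C + h l 0) / `|(beta l)%:C + h l 0|.
  by rewrite -dyl normrM d1 mul1r mulrA.
apply: le_trans (phase_approx b0 small) _.
apply: ler_wpM2r; first exact: normc_ge0.
by apply: ler_pM; rewrite ?normc_ge0 ?divr_ge0 ?beta_ge0 ?hL.
Qed.

End PhaseApproximation.

(** * A tube around the fixed points that the iteration contracts *)

Section DouglasRachford.
Variable R : realType.
Local Notation C := R[i].
Local Notation "r %:C" := (real_complex R r).
Local Notation normc := ComplexField.Normc.normc.

Lemma norm_phase m (y : 'cV[C]_m) l : `|phase y l 0| = 1.
Proof.
rewrite mxE; have [_|y0] := eqVneq (y l 0) 0; first exact: normr1.
by rewrite normrM normfV normr_id divff // normr_eq0.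
Qed.

Lemma phase_conj_mul m (y : 'cV[C]_m) l :
  (phase y l 0)^* * y l 0 = (normc (y l 0))%:C.
Proof.
rewrite -normC_normc mxE; have [->|y0] := eqVneq (y l 0) 0.
  by rewrite normr0 mulr0.
by rewrite rmorphM /= fmorphV /= conj_normC mulrAC [_^* * _]mulrC -normCK expr2 mulfK
  ?normr_eq0.
Qed.

Variables (n N : nat) (x0 : 'cV[C]_n) (A : 'M[C]_(n, N)) (s : R).
Hypothesis isoA : A *m A ^t* = 1%:M.

Let z0 := A ^t* *m x0.
Let D := diag_mx (phase z0)^T.
Let B := Bmx A x0.
Let beta l := normc (z0 l 0).
Let b := realvec beta.
Let Q := skewproj beta.
Let j : 'cV[C]_n := 'i *: x0.

Hypothesis s_ge0 : 0 <= s.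
Hypothesis s_lt1 : s < 1.
Hypothesis gap : forall u, rdot u j = 0 -> enorm (Q (B ^t* *m u)) <= s * enorm u.
Hypothesis x0_neq0 : x0 != 0.

Lemma diag_phase_adjE m (v : 'M[C]_(N, m)) l i :
  (D ^t* *m v) l i = (phase z0 l 0)^* * v l i.
Proof. by rewrite tr_diag_mx map_diag_mx mul_diag_mx !mxE. Qed.

Lemma diag_phaseK m (v : 'M[C]_(N, m)) : D *m (D ^t* *m v) = v.
Proof.
apply/matrixP => l i; rewrite mul_diag_mx mxE diag_phase_adjE [_^T _ _]mxE mulrA.
by rewrite -normCK norm_phase expr1n mul1r.
Qed.

Lemma Bmx_adj m (u : 'M[C]_(n, m)) : B ^t* *m u = D ^t* *m (A ^t* *m u).
Proof. by rewrite /B /Bmx -/z0 -/D trmx_mul map_mxM /= mulmxA. Qed.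

Lemma mulmx_Bmx m (v : 'M[C]_(N, m)) : A *m v = B *m (D ^t* *m v).
Proof. by rewrite /B /Bmx -/z0 -/D -mulmxA diag_phaseK. Qed.

Lemma Bmx_coisometry : B *m B ^t* = 1%:M.
Proof.
have := Bmx_adj 1%:M; rewrite !mulmx1 => ->.
by rewrite -mulmx_Bmx.
Qed.

Lemma beta_ge0 l : 0 <= beta l. Proof. exact: normc_ge0. Qed.

Lemma vabs_realvec : vabs z0 = b.
Proof. by apply/colP => l; rewrite [LHS]mxE [RHS]mxE. Qed.

Lemma Bmx_adj_x0 : B ^t* *m x0 = b.
Proof.
by apply/colP => l; rewrite Bmx_adj diag_phase_adjE -/z0 phase_conj_mul [RHS]mxE.
Qed.

Lemma Bmx_adj_j : 'i *: b = B ^t* *m j.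
Proof. by rewrite /j -scalemxAr Bmx_adj_x0. Qed.

Lemma Bmx_b : B *m b = x0.
Proof. by rewrite -Bmx_adj_x0 mulmxA Bmx_coisometry mul1mx. Qed.

Lemma enorm_Bmx_adj u : enorm (B ^t* *m u) = enorm u.
Proof. by rewrite !enormE rdot_coisometry //; exact: Bmx_coisometry. Qed.

Lemma enorm_Bmx_le w : enorm (B *m w) <= enorm w.
Proof.
have h : enorm (B *m w) * enorm (B *m w) <= enorm w * enorm (B *m w).
  rewrite -expr2 sqr_enorm rdot_mulmxl -[X in _ * X]enorm_Bmx_adj.
  exact: rdot_le_enorm.
have [->|n0] := eqVneq (enorm (B *m w)) 0; first exact: enorm_ge0.
by rewrite -(ler_pM2r (_ : 0 < enorm (B *m w))) // lt_def n0 enorm_ge0.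
Qed.

Lemma enorm_b : enorm b = enorm x0.
Proof. by rewrite -Bmx_adj_x0 enorm_Bmx_adj. Qed.

Lemma enorm_b_gt0 : 0 < enorm b.
Proof.
rewrite lt_def enorm_ge0 andbT enorm_b; apply: contraNneq x0_neq0.
by move/enorm_eq0 => ->.
Qed.

Lemma skewproj_j : Q (B ^t* *m j) = B ^t* *m j.
Proof. by rewrite -Bmx_adj_j; exact: skewproj_imag_realvec. Qed.

(* Coordinates with [beta l = 0] contribute [6 / 0 = 0]. *)
Let L := \sum_l 6 / beta l.

Lemma sum_inv_modulus_ge0 : 0 <= L.
Proof. by apply: sumr_ge0 => l _; rewrite divr_ge0 ?beta_ge0. Qed.

Lemma sum_inv_modulus_ge l : beta l != 0 -> 6 / beta l <= L.
Proof.
move=> _; rewrite /L (bigD1 l) //= lerDl.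
by apply: sumr_ge0 => i _; rewrite divr_ge0 ?beta_ge0.
Qed.

(** The first bound puts the iterate within reach of [gauge_near]; the second lets the remainder,
    amplified by 9, consume at most half of 1 - s. *)
Definition radius := Num.min (enorm b / 2) ((1 - s) / (18 * (L + 1))).

Lemma radius_gt0 : 0 < radius.
Proof.
rewrite lt_min divr_gt0 ?enorm_b_gt0 //= divr_gt0 ?subr_gt0 //.
by rewrite mulr_gt0 // ltr_wpDl ?sum_inv_modulus_ge0.
Qed.

Lemma radius_L : 9 * (L * radius) <= (1 - s) / 2.
Proof.
have L0 := sum_inv_modulus_ge0; have L1 : 0 < L + 1 by lra.
have : radius <= (1 - s) / (18 * (L + 1)) by rewrite /radius ge_min lexx orbT.
rewrite ler_pdivlMr ?mulr_gt0 // => h; have := radius_gt0; nra.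
Qed.

Lemma radius_b : radius <= enorm b / 2.
Proof. by rewrite /radius ge_min lexx. Qed.

(* The points [D (b + k)] with [k] small neutral are fixed by [Sf]; [y] is within
   [r] of a rotation of one of them, in a direction transversal to both. *)
Definition tube (y : 'cV[C]_N) (r : R) := exists c k w,
  [/\ `|c| = 1, c *: (D ^t* *m y) = b + k + w, neutral B Q k,
      transverse B Q j w & enorm w <= r /\ enorm k + 2 * enorm w <= radius].

Lemma tube_init x : enorm (x - x0) <= radius / 2 ->
  tube (A ^t* *m x) (enorm (x - x0)).
Proof.
move=> xx; have x0p : 0 < enorm x0 by rewrite -enorm_b enorm_b_gt0.
have r0 := radius_gt0; have rb := radius_b; rewrite enorm_b in rb.
have [|c [c1 cj cl _]] := @gauge_near _ _ x0 x x0p; first by lra.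
(* The start lies in the range of A^* and has no neutral part; after alignment of [x] with [x0], the
   deviation in the range of B^* is already transverse. *)
exists c, 0, (B ^t* *m (c *: x - x0)); split=> //.
- by rewrite addr0 mulmxBr Bmx_adj_x0 addrC subrK -scalemxAr Bmx_adj.
- by split; [exact: mulmx0 | apply/colP => l; rewrite !mxE; case: (beta l == 0)].
- split=> [k [Bk _]|]; first by rewrite -rdot_mulmxr Bk rdot0r.
  rewrite rdot_coisometry; last exact: Bmx_coisometry.
  by rewrite rdotDl cj rdotNl rdot_imag oppr0 addr0.
by rewrite enorm_Bmx_adj enorm0; split=> //; lra.
Qed.

(** The phase of the tube competes with the optimal [alpha], and for it the error is B w, because B
    b = x0 and B k = 0. *)
Lemma tube_bound y r alpha : tube y r -> phase_argmin (A *m y) x0 alpha ->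
  enorm (alpha *: (A *m y) - x0) <= r.
Proof.
move=> [c [k [w [c1 cy [Bk _] _ [wr _]]]]] [_ /(_ _ c1) h].
apply: le_trans h (le_trans _ wr).
rewrite mulmx_Bmx scalemxAr cy !mulmxDr Bk Bmx_b addr0 addrC addKr.
exact: enorm_Bmx_le.
Qed.

Lemma tube_Sf y r : tube y r -> tube (Sf A (vabs z0) y) ((1 + s) / 2 * r).
Proof.
move=> [c [k [w [c1 cy Kk Tw [wr kw]]]]].
pose d : 'cV[C]_N := \col_l (c * (phase z0 l 0)^*).
have dE v : vmul d v = c *: (D ^t* *m v).
  by apply/colP => l; rewrite [RHS]mxE diag_phase_adjE !mxE mulrA.
have d1 l : `|d l 0| = 1 by rewrite mxE normrM c1 norm_conjC norm_phase mulr1.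
pose h := k + w.
have dy : vmul d y = b + h by rewrite dE cy addrA.
have hr : enorm h <= radius.
  by apply: le_trans (enormD _ _) _; have := enorm_ge0 w; lra.
have L0 := sum_inv_modulus_ge0; have Lr := radius_L; have r0 := radius_gt0.
have Lh : L * enorm h <= L * radius by rewrite ler_wpM2l.
pose E := vmul d (vmul b (phase y)) - b - Q h.
(* The remainder is thus proportional to |w|, however large |k| is within [radius]. *)
have Qh : Q h = Q w by case: Kk => _ Qk; rewrite /h /Q skewprojD -/Q Qk add0r.
have nE : enorm E <= L * radius * enorm w.
  apply: le_trans (vmul_phase_approx beta_ge0 L0 sum_inv_modulus_ge d1 dy _) _.
    apply: le_trans Lh _; move: Lr s_ge0; set t := L * radius; lra.
  by rewrite -[skewproj beta h]/(Q h) Qh; apply: ler_pM;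
    rewrite ?mulr_ge0 ?enorm_ge0 ?enorm_skewproj_le.
have w0 := enorm_ge0 w.
have nE2 : 9 * enorm E <= (1 - s) / 2 * enorm w.
  by have := ler_wpM2r w0 Lr; lra.
(* Here P b = b and P k = 0, so the terms in [b] and [k] reproduce themselves. *)
have PS : c *: (D ^t* *m Sf A (vabs z0) y) = b + k + linstep B Q w + refl B E.
  have bE : vmul d (vmul b (phase y)) = b + Q w + E.
    by rewrite /E Qh; apply/colP => l; rewrite !mxE; ring.
  move: bE; rewrite dE /Sf vabs_realvec; set F := vmul b (phase y) => bE.
  rewrite mulmxBr mulmxDr -Bmx_adj mulmx_Bmx mulmxBr -scalemxAr.
  have lin p f : c *: (p + B ^t* *m (B *m (2 *: f - p)) - f) =
      c *: p + B ^t* *m (B *m (2 *: (c *: f) - c *: p)) - c *: f.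
    by rewrite scalerBr scalerDr !scalemxAr scalerBr !scalerA [c * 2]mulrC.
  rewrite lin cy bE.
  case: Kk => Bk _; rewrite /linstep /refl.
  rewrite !(mulmxDr, mulmxBr, mulmxN, =^~ scalemxAr) Bk mulmx0 Bmx_b Bmx_adj_x0.
  set X1 := B ^t* *m _; set X2 := B ^t* *m _; set X3 := B ^t* *m _.
  by apply/colP => l; rewrite !mxE; ring.
have ew : enorm (refl B E) <= enorm w.
  rewrite refl_enorm; last exact: Bmx_coisometry.
  by move: nE2 s_ge0; nra.
have small : enorm k + 2 * enorm w <= enorm b / 2.
  exact: le_trans kw radius_b.
have [c' [k' [w' [c'1 eq Kk' Tw' [nw nk]]]]] :=
  gauge_step Bmx_coisometry (skewprojD beta) (skewprojZ beta) (skewproj_sym beta)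
    (skewprojK beta) skewproj_j s_ge0 s_lt1 gap Bmx_adj_j enorm_b_gt0 Kk Tw ew small.
rewrite refl_enorm in nw nk; last exact: Bmx_coisometry.
exists (c' * c), k', w'; split=> //.
- by rewrite normrM c'1 c1 mulr1.
- by rewrite -scalerA PS eq.
(* The error adds 27 |E| <= 3 (1 - s) / 2 |w| to |k| + 2 s |w|; as 2 s + 3 (1 - s) / 2 <= 2, the
   quantity |k| + 2 |w| does not grow. *)
have sw : 0 <= (1 - s) * enorm w by rewrite mulr_ge0 // subr_ge0 ltW.
split; last by lra.
have s2 : 0 <= (1 + s) / 2 by have := s_ge0; lra.
by have := ler_wpM2l s2 wr; lra.
Qed.
End DouglasRachford.

(** * Local geometric convergence *)

Local Open Scope classical_set_scope.

Theorem theorem4p1 (R : realType) (n N : nat)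
    (x0 : 'cV[R[i]]_n) (A : 'M[R[i]]_(n, N))
    (isoA : A *m A ^t* = 1%:M)
    (leN : (2 * n <= N)%N)
    (gap : exists2 s : R,
       is_max [set (enorm u)^-1 * enorm (vIm ((Bmx A x0) ^t* *m u))
              | u in [set u : 'cV[R[i]]_n | u <> 0 /\ rperp ('i *: u) x0]] s
       & s < 1) :
  exists delta gamma : R,
    [/\ 0 < delta, 0 <= gamma, gamma < 1 &
      forall (y : nat -> 'cV[R[i]]_N) (x : nat -> 'cV[R[i]]_n)
             (alpha : nat -> R[i]),
        FDR_seq A (vabs (A ^t* *m x0)) y ->
        (forall k, (0 < k)%N -> x k = A *m y k) ->
        y 1%N = A ^t* *m x 1%N ->
        (forall k, (0 < k)%N -> phase_argmin (x k) x0 (alpha k)) ->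
        enorm (x 1%N - x0) < delta ->
        forall k, (0 < k)%N ->
          enorm (alpha k *: x k - x0) <= gamma ^+ k.-1 * enorm (x 1%N - x0)].
Proof.
case: gap => s [[u0 _ us] smax] s1.
have s0 : 0 <= s by rewrite -us mulr_ge0 ?invr_ge0 ?enorm_ge0.
have [->|x0n] := eqVneq x0 0.
  (* For x0 = 0 the map is y - A^* A y, so x vanishes from index 2 on and the rate 0 works; at index
     1 the factor is 0 ^+ 0 = 1. *)
  exists 1, 0; split=> // y x alpha Fy xy _ am _ [|[|k]] // _.
    have [_ h] := am 1%N isT; have := h 1 (normr1 _).
    by rewrite expr0 mul1r scale1r.
  rewrite xy // Fy // /Sf mulmx0.
  have b0 : vabs (0 : 'cV[R[i]]_N) = 0 by apply/colP => l; rewrite !mxE normr0.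
  have v0 w : vmul (vabs (0 : 'cV[R[i]]_N)) w = 0.
    by rewrite b0; apply/colP => l; rewrite !mxE mul0r.
  rewrite v0 scaler0 sub0r !subr0 mulmxDr (mulmxA A) isoA mul1mx mulmxN subrr.
  by rewrite scaler0 enorm0 mulr_ge0 ?exprn_ge0 ?enorm_ge0.
(* Q only keeps part of the imaginary parts, so the maximum bounds it; u = 0 is treated apart
   because the maximum ranges over nonzero vectors. *)
have gapQ u : rdot u ('i *: x0) = 0 ->
    enorm (skewproj (fun l => ComplexField.Normc.normc ((A ^t* *m x0) l 0))
      ((Bmx A x0) ^t* *m u)) <= s * enorm u.
  move=> uj; apply: le_trans (enorm_skewproj_le_vIm _ _) _.
  have [->|un0] := eqVneq u 0.
    rewrite mulmx0 enorm0 mulr0 -[leRHS](enorm0 R N) -[leRHS]mul1r.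
    apply: enorm_coord_le => // l.
    by rewrite mul1r !mxE normc_Im normr0 normc_ge0.
  have up : 0 < enorm u.
    by rewrite lt_def enorm_ge0 andbT; apply: contraNneq un0 => /enorm_eq0 ->.
  rewrite -ler_pdivrMr // mulrC; apply: smax; exists u => //; split; first exact/eqP.
  by rewrite /rperp Re_algRe -/(rdot _ _) rdot_imagl uj oppr0.
(* The half of [radius] accounts for the weight 2 on |w| in [tube]; the rate is the midpoint of s
   and 1. *)
exists (radius x0 A s / 2), ((1 + s) / 2); split.
- by rewrite divr_gt0 // radius_gt0.
- by rewrite divr_ge0 // addr_ge0.
- by rewrite ltr_pdivrMr //; move: s1; clear; lra.
move=> y x alpha Fy xy y1 am x1 k k0; rewrite xy //.
apply: (tube_bound isoA _ (s := s)); last by rewrite -xy //; exact: am.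
case: k k0 => // k _ /=; elim: k => [|k IH].
  by rewrite expr0 mul1r y1; apply: tube_init => //; exact: ltW.
by rewrite Fy // exprS -mulrA; apply: tube_Sf.
Qed.
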